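(* Let $k\geq 3$ be an integer and let $d=2k^2$. If $q$ is an even power of a prime $p\equiv 1\pmod d$, then $A\hat{+}A\neq S_d$ for every $A\subset\mathbb{F}_q$.
   Context: $S_d=\{x^d: x\in\mathbb{F}_q^*\}$, the subgroup of $\mathbb{F}_q^*$ of order $\frac{q-1}{d}$. For $A\subset\mathbb{F}_q$, $A\hat{+}A=\{a+b: a,b\in A,\ a\neq b\}$. *)

(* Defs.v *)
From HB Require Import structures.
From mathcomp Require Import all_boot all_order all_algebra all_fingroup all_solvable all_field.
Set Implicit Arguments.
Unset Strict Implicit.
Unset Printing Implicit Defensive.
Import GRing.Theory.
Local Open Scope ring_scope.

Definition power_subgroup (F : finFieldType) (d : nat) : {set F} :=
  [set x ^+ d | x in [set x : F | x != 0]].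

Definition restricted_sumset (F : finFieldType) (A : {set F}) : {set F} :=
  [set ab.1 + ab.2 | ab in [set ab : F * F |
     [&& ab.1 \in A, ab.2 \in A & ab.1 != ab.2]]].

(* Main.v *)
Require Import Defs.
From HB Require Import structures.
From mathcomp Require Import all_boot all_order all_algebra all_fingroup all_solvable all_field.
From mathcomp Require Import zify.

(** Stepanov's method. Put [r = p ^ (n / 2) = 2 k^2 D0 + 1], [D = (q - 1) / d = D0 (r + 1)] and
    [t = k D0], so that [2 D = (2 t)^2 + 4 D0]. Counting pairs, [A^+A = S_d] forces
    [#|A| > 2 t]; keep [2 t + 1] elements [B] of [A]. With the Lagrange weights [w] of [B], which
    kill all polynomials of degree less than [2 t], consider
    [f = \sum_a w_a (X + a)^(D + t) (X - a)^t - (-1)^t], of degree at most [D]. As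
    [(a + b)^D = 1] for [a != b], and as the factor [(X - b)^t] silences the term [a = b], [f]
    vanishes to order [t] at every [b] in [B]. Since [(2 t + 1) t > D] (this is [k >= 3]), [f]
    must be zero. But the coefficient of order [t] of [f] at [b] is
    [w_b ((2 b)^(D + t) - (2 b)^t)], so [(2 b)^D = 1] or [2 b = 0] for all [b] in [B]: now the
    diagonal sums behave as well. Hence [\sum_a w_a (X + a)^(D + 2 t) - 1] vanishes to order
    [2 t] on [B]; its coefficient of degree [D] is ['C(D + 2 t, D)], which is nonzero in
    characteristic [p] because the base [p] addition of [D] and [2 t] has no carry. Then
    [(2 t + 1) 2 t <= D], a contradiction. *)

Set Implicit Arguments.
Unset Strict Implicit.
Unset Printing Implicit Defensive.

Import GRing.Theory.
Local Open Scope ring_scope.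

(** * Lagrange interpolation *)

Section Interpolation.

Variables (F : fieldType) (B : seq F) (m : nat).
Hypotheses (uniqB : uniq B) (sizeB : size B = m.+1).

Definition lagrange_weight (b : F) : F := (\prod_(x <- B | x != b) (b - x))^-1.

Lemma lagrange_weight_neq0 b : lagrange_weight b != 0.
Proof.
rewrite invr_eq0 prodf_seq_neq0; apply/allP => x _.
by apply/implyP => xb; rewrite subr_eq0 eq_sym.
Qed.

(** [g] is its own interpolant on the [m.+1] nodes, and each basis polynomial [L b] is monic of
    degree [m]. The sum is the divided difference of [g]. *)
Lemma lagrange_top_coef (g : {poly F}) :
  (size g <= m.+1)%N -> \sum_(b <- B) lagrange_weight b * g.[b] = g`_m.
Proof.
move=> sg.
pose L b := \prod_(x <- B | x != b) ('X - x%:P).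
have sL b : b \in B -> size (L b) = m.+1.
  move=> bB; rewrite /L -big_filter size_prod_XsubC -rem_filter //.
  by rewrite size_rem // sizeB.
have LE b c : (L b).[c] = \prod_(x <- B | x != b) (c - x).
  by rewrite /L horner_prod; apply: eq_bigr => x _; rewrite !hornerE.
have Lm b : b \in B -> (L b)`_m = 1.
  move=> bB; have := lead_coef_prod_XsubC B (fun x => x != b) id.
  by rewrite -[X in lead_coef X]/(L b) lead_coefE sL.
pose S := \sum_(b <- B) (lagrange_weight b * g.[b]) *: L b.
suff Sg : S = g.
  rewrite -[in RHS]Sg coef_sum big_seq [RHS]big_seq; apply: eq_bigr => b bB.
  by rewrite coefZ Lm // mulr1.
apply/eqP; rewrite -subr_eq0; apply/eqP.
apply: (@roots_geq_poly_eq0 _ _ B) => //.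
  apply/allP => c cB; apply/rootP; rewrite hornerD hornerN /S horner_sum.
  rewrite (bigD1_seq c) //= big1 ?addr0 => [|b bc].
    rewrite hornerZ LE mulrAC mulVf ?mul1r ?subrr //.
    by rewrite -invr_eq0 lagrange_weight_neq0.
  rewrite hornerZ LE (_ : \prod_(_ <- _ | _) _ = 0) ?mulr0 //.
  apply/eqP; rewrite prodf_seq_eq0; apply/hasP; exists c => //=.
  by rewrite eq_sym bc subrr eqxx.
rewrite sizeB; apply: leq_trans (size_polyD _ _) _.
rewrite size_polyN geq_max sg andbT /S.
rewrite big_seq; apply: leq_trans (size_sum _ _ _) _.
apply/bigmax_leqP_seq => b _ bB.
by apply: leq_trans (size_scale_leq _ _) _; rewrite sL.
Qed.

End Interpolation.

(** * Coefficients and multiple roots of polynomials *)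

Section PolynomialFacts.

Variable F : fieldType.

Lemma coef_XaddC_exp (u : F) n i :
  (('X + u%:P) ^+ n)`_i = u ^+ (n - i) *+ 'C(n, i).
Proof.
rewrite addrC exprDn coef_sum.
have term j : ((u%:P ^+ (n - j) * 'X^j *+ 'C(n, j)) : {poly F})`_i
    = (u ^+ (n - j) *+ 'C(n, j)) *+ (i == j).
  by rewrite coefMn -rmorphXn coefCM coefXn mulr_natr mulrnAC.
have [lin|lni] := leqP i n.
  rewrite (bigD1 (Ordinal (lin : (i < n.+1)%N))) //= term eqxx mulr1n.
  by rewrite big1 ?addr0 // => j /negPf ji; rewrite term eq_sym (ji : (_ == i) = false).
rewrite bin_small // mulr0n big1 // => j _.
by rewrite term eqn_leq leqNgt (leq_trans (ltn_ord j)).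
Qed.

Lemma coef_XaddC_expM (u v : F) n t w :
  (('X + u%:P) ^+ n * ('X + v%:P) ^+ t)`_w =
  \sum_(i < w.+1) (u ^+ (n - i) *+ 'C(n, i)) * (v ^+ (t - (w - i)) *+ 'C(t, w - i)).
Proof. by rewrite coefM; apply: eq_bigr => i _; rewrite !coef_XaddC_exp. Qed.

Lemma size_XaddC_exp (u : F) n : size (('X + u%:P) ^+ n) = n.+1.
Proof. by rewrite -[u]opprK polyCN size_exp_XsubC. Qed.

(** Translation moves [b] to 0, where the order of vanishing can be read off the coefficients. *)
Lemma dvdp_XsubC_exp (f : {poly F}) b t :
  (forall i, (i < t)%N -> (f \Po ('X + b%:P))`_i = 0) -> ('X - b%:P) ^+ t %| f.
Proof.
move=> f0; set g := f \Po _ in f0.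
have gX : 'X^t %| g.
  rewrite -[g](poly_take_drop t) (_ : take_poly t g = 0) ?add0r ?dvdp_mull //.
  by apply/polyP => i; rewrite coef_take_poly coef0; case: ltnP => // /f0.
have := dvdp_comp_poly ('X - b%:P) gX.
by rewrite /g comp_polyXaddC_K rmorphXn /= comp_polyX.
Qed.

Lemma multiple_roots_bound (f : {poly F}) (B : seq F) t :
  uniq B -> f != 0 -> (forall b, b \in B -> ('X - b%:P) ^+ t %| f) ->
  (size B * t < size f)%N.
Proof.
move=> uB f0 dvd.
have: (\prod_(b <- B) ('X - b%:P)) ^+ t %| f.
  elim: B uB dvd => [|b B IH] /=; first by rewrite big_nil expr1n dvd1p.
  case/andP=> bB uB dvd; rewrite big_cons exprMn Gauss_dvdp.
    by rewrite dvd ?mem_head // IH // => x xB; rewrite dvd // inE xB orbT.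
  by rewrite coprimep_expl // coprimep_expr // coprimep_sym coprimep_XsubC root_prod_XsubC.
move/(dvdp_leq f0); apply: leq_trans.
have P0 : (\prod_(b <- B) ('X - b%:P)) ^+ t != 0.
  by rewrite expf_neq0 // monic_neq0 // monic_prod_XsubC.
by rewrite -ltnS -[X in (_ < X.+1)%N]prednK ?size_poly_gt0 // size_exp size_prod_XsubC.
Qed.

End PolynomialFacts.

(** * The auxiliary polynomials *)

Section Stepanov.

Variables (F : fieldType) (B : seq F) (D s t : nat).
Hypotheses (uniqB : uniq B) (sizeB : size B = (s + t).+1).

Local Notation w := (lagrange_weight B).

(** Two cases serve below: [s = t], and then [t + t] and [0] in place of [s] and [t], with the same
    nodes. *)
Definition stepanov_poly : {poly F} :=
  \sum_(a <- B) w a *: (('X + a%:P) ^+ (D + s) * ('X - a%:P) ^+ t)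
  - ((-1) ^+ t)%:P.

(** By homogeneity the coefficient of degree [j] in a summand is a constant times
    [a ^+ (D + s + t - j)]. For [j > D] this exponent is below [s + t], so the weights kill it. *)
Lemma size_stepanov_poly : (0 < s + t)%N -> (size stepanov_poly <= D.+1)%N.
Proof.
move=> m_gt0; apply/leq_sizeP => j ltDj.
rewrite coefB coefC gtn_eqF ?subr0 ?(leq_trans _ ltDj) // coef_sum.
pose K := \sum_(i < j.+1) ((-1) ^+ (t - (j - i)) *+ 'C(t, j - i)) *+ 'C(D + s, i) : F.
have homog a :
    (('X + a%:P) ^+ (D + s) * ('X - a%:P) ^+ t)`_j = a ^+ (D + s + t - j) * K.
  rewrite -polyCN coef_XaddC_expM mulr_sumr; apply: eq_bigr => i _.
  have [i_le|i_gt] := leqP i (D + s); last first.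
    by rewrite (bin_small i_gt) !mulr0n mul0r mulr0.
  have [ji_le|ji_gt] := leqP (j - i) t; last first.
    by rewrite (bin_small ji_gt) !mulr0n mul0rn !mulr0.
  have -> : (D + s + t - j = (D + s - i) + (t - (j - i)))%N by have := ltn_ord i; lia.
  by rewrite exprD [(- a) ^+ _]exprNn [(-1) ^+ _ * _]mulrC !mulrnAl !mulrnAr mulrA.
transitivity (K * \sum_(a <- B) w a * ('X^(D + s + t - j)).[a]).
  rewrite mulr_sumr; apply: eq_bigr => a _.
  by rewrite coefZ homog hornerXn mulrA mulrC.
rewrite (lagrange_top_coef uniqB sizeB) ?size_polyXn; last by lia.
by rewrite coefXn (_ : (_ == _) = false) ?mulr0 //; lia.
Qed.

(** Replacing [(b + a) ^+ D] by 1 is correct for [a != b], and the sum so simplified cancels the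
    constant. Only the error at [a = b] remains; there [0] stands for [b - a], so a term can survive
    only if [l - i = t]. *)
Lemma coef_stepanov_poly_shift b l :
  b \in B -> {in B, forall a, a != b -> (b + a) ^+ D = 1} -> (l <= s)%N ->
  (stepanov_poly \Po ('X + b%:P))`_l =
  w b * \sum_(i < l.+1) (((b + b) ^+ (D + s - i) - (b + b) ^+ (s - i)) *+ 'C(D + s, i))
                         * (0 ^+ (t - (l - i)) *+ 'C(t, l - i)).
Proof.
move=> bB sumB le_ls.
pose T (a : F) i : F := (b - a) ^+ (t - (l - i)) *+ 'C(t, l - i).
(* The simplified coefficient, as a polynomial in [a]. *)
pose g : {poly F} := \sum_(i < l.+1) (('X + b%:P) ^+ (s - i) *+ 'C(D + s, i))
                                     * ((b%:P - 'X) ^+ (t - (l - i)) *+ 'C(t, l - i)).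
have gE a : g.[a] = \sum_(i < l.+1) ((b + a) ^+ (s - i) *+ 'C(D + s, i)) * T a i.
  rewrite /g horner_sum; apply: eq_bigr => i _.
  by rewrite hornerM !hornerMn !horner_exp !hornerE [a + b]addrC.
have shiftE a : ((w a *: (('X + a%:P) ^+ (D + s) * ('X - a%:P) ^+ t)) \Po ('X + b%:P))`_l
   = w a * \sum_(i < l.+1) ((b + a) ^+ (D + s - i) *+ 'C(D + s, i)) * T a i.
  rewrite comp_polyZ coefZ rmorphM !rmorphXn /= rmorphD rmorphB /= comp_polyX !comp_polyC.
  rewrite -!addrA -polyCN -!polyCD coef_XaddC_expM.
  by congr (_ * _).
have size_term i : (i < l.+1)%N -> (l - i <= t)%N ->
    (size (('X + b%:P) ^+ (s - i) * (b%:P - 'X) ^+ (t - (l - i)))%R <= (s + t - l).+1)%N.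
  move=> il lit; apply: leq_trans (size_polyMleq _ _) _.
  by rewrite -opprB exprNn size_Msign size_XaddC_exp size_exp_XsubC; lia.
have size_g : (size g <= (s + t - l).+1)%N.
  apply: leq_trans (size_sum _ _ _) _; apply/bigmax_leqP => i _.
  have [lit|lit] := leqP (l - i) t; last first.
    by rewrite (bin_small lit) mulr0n mulr0 size_poly0.
  rewrite mulrnAl mulrnAr -mulrnA -scaler_nat.
  by apply: leq_trans (size_scale_leq _ _) _; apply: size_term.
(* The degree of [g] is at most [s + t - l], so only [l = 0] reaches the top; the sign comes from
   [(b - X)^t]. *)
have g_top : g`_(s + t) = (-1) ^+ t *+ (l == 0)%N.
  have [l0|l_gt0] := posnP l; last first.
    by rewrite nth_default // (leq_trans size_g) //; lia.
  rewrite /g l0 big_ord1 !bin0 !subn0 !mulr1n -opprB [(- ('X - _)) ^+ _]exprNn mulrCA.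
  rewrite (_ : (-1) ^+ t = ((-1) ^+ t)%:P); last by rewrite rmorphXn /= polyCN.
  rewrite coefCM.
  rewrite (_ : _`_ _ = lead_coef (('X + b%:P) ^+ s * ('X - b%:P) ^+ t)).
    by rewrite lead_coefM !lead_coef_exp lead_coefXaddC lead_coefXsubC !expr1n !mulr1.
  by rewrite lead_coefE size_monicM ?monic_exp ?monicXaddC ?expf_neq0 ?polyXsubC_eq0 //
     size_XaddC_exp size_exp_XsubC addnS.
rewrite /stepanov_poly rmorphB /= comp_polyC coefB coefC raddf_sum coef_sum /=.
under eq_bigr => a _ do rewrite shiftE.
have -> : (if l == 0%N then (-1) ^+ t else 0) = \sum_(a <- B) w a * g.[a].
  by rewrite (lagrange_top_coef uniqB sizeB) ?g_top; [case: eqP | lia].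
rewrite -sumrB (bigD1_seq b) //= [X in _ + X]big_seq_cond [X in _ + X]big1 ?addr0 => [|a].
  rewrite -mulrBr gE -sumrB; congr (_ * _); apply: eq_bigr => i _.
  by rewrite -mulrBl -mulrnBl /T subrr.
case/andP=> aB ab; rewrite gE -mulrBr -sumrB big1 ?mulr0 // => i _.
by rewrite -addnBA ?exprD ?(sumB a) ?mul1r ?subrr //; have := ltn_ord i; lia.
Qed.

End Stepanov.

Lemma pairwise_sum_root_bound (F : fieldType) (B : seq F) (D t : nat) :
  uniq B -> size B = (t + t).+1 -> (0 < t)%N -> (0 < D)%N ->
  {in B &, forall a b, a != b -> (b + a) ^+ D = 1} ->
  ('C(D + (t + t), D))%:R != 0 :> F -> (size B * t <= D)%N.
Proof.
move=> uniqB sizeB t_gt0 D_gt0 sumB binF.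
pose f := stepanov_poly B D t t.
have size_f : (size f <= D.+1)%N by rewrite size_stepanov_poly // addn_gt0 t_gt0.
have [f0|f_neq0] := eqVneq f 0; last first.
  rewrite -ltnS; apply: leq_trans size_f; apply: multiple_roots_bound => // b bB.
  apply: dvdp_XsubC_exp => l ltlt.
  rewrite (coef_stepanov_poly_shift uniqB sizeB) //; last exact: ltnW.
    rewrite big1 ?mulr0 // => i _.
    by rewrite [0 ^+ _]expr0n gtn_eqF ?mul0rn ?mulr0 //; lia.
  by move=> a aB ab; apply: sumB.
(* The factor with exponent [j > 0] covers [b + b = 0] too. In the coefficient of order [t] only
   [i = 0] survives. *)
have double b j : b \in B -> (0 < j)%N -> (b + b) ^+ (D + j) = (b + b) ^+ j.
  move=> bB j_gt0.
  have /eqP : (f \Po ('X + b%:P))`_t = 0 by rewrite f0 comp_poly0 coef0.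
  rewrite (coef_stepanov_poly_shift uniqB sizeB) //; last by move=> a aB ab; apply: sumB.
  rewrite mulf_eq0 (negPf (lagrange_weight_neq0 _ _)) big_ord_recl big1 => [|i _].
    rewrite /= !subn0 subnn binn bin0 expr0 !mulr1n mulr1 addr0 subr_eq0 exprD.
    have [-> _|bb0] := eqVneq (b + b) 0.
      by rewrite !expr0n !gtn_eqF // addn_gt0 j_gt0 orbT.
    rewrite -[X in _ == X]mul1r (inj_eq (mulIf _)) ?expf_neq0 // => /eqP bD.
    by rewrite exprD bD mul1r.
  by rewrite [0 ^+ _]expr0n gtn_eqF ?mul0rn ?mulr0 // lift0 /=; have := ltn_ord i; lia.
pose g := stepanov_poly B D (t + t) 0.
have sizeB0 : size B = (t + t + 0).+1 by rewrite addn0.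
have size_g : (size g <= D.+1)%N.
  by rewrite size_stepanov_poly // addn0 addn_gt0 t_gt0.
have g_neq0 : g != 0.
  (* In degree [D] the summand of [a] contributes a binomial times [a ^+ (t + t)], whose weighted
     sum is 1. *)
  apply: contraNneq binF => g0; apply/eqP.
  have: g`_D = 0 by rewrite g0 coef0.
  rewrite coefB coefC gtn_eqF // subr0 coef_sum => <-.
  transitivity ('C(D + (t + t), D)%:R * \sum_(a <- B) lagrange_weight B a * ('X^(t + t)).[a]).
    by rewrite (lagrange_top_coef uniqB sizeB) ?size_polyXn // coefXn eqxx mulr1.
  rewrite mulr_sumr; apply: eq_bigr => a _.
  by rewrite coefZ expr0 mulr1 coef_XaddC_exp hornerXn addKn mulrCA mulr_natl.
apply: leq_trans (_ : size B * (t + t) <= D)%N; first by rewrite leq_mul2l leq_addr orbT.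
rewrite -ltnS; apply: leq_trans size_g; apply: multiple_roots_bound => // b bB.
apply: dvdp_XsubC_exp => l ltl.
rewrite (coef_stepanov_poly_shift uniqB sizeB0) //; last exact: ltnW.
  rewrite big1 ?mulr0 // => i _.
  by rewrite -addnBA ?double ?subrr ?mul0rn ?mul0r //; have := ltn_ord i; lia.
by move=> a aB ab; apply: sumB.
Qed.

(* Binomial coefficients and carries in base [p] *)
Local Close Scope ring_scope.

(** Legendre's formula: without carries every quotient by [p ^ k] is additive, so [(a + b)!] and
    [a! b!] have the same [p]-adic valuation. *)
Lemma prime_ndvd_bin_no_carry p a b :
  prime p -> (forall i, a %% p ^ i + b %% p ^ i < p ^ i) -> ~~ (p %| 'C(a + b, a)).
Proof.
move=> pP nocarry.
have bin_gt0' : 0 < 'C(a + b, a) by rewrite bin_gt0 leq_addr.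
rewrite -(expn1 p) pfactor_dvdn // -leqNgt leqn0 -(eqn_add2r (logn p (a`! * b`!))).
have := bin_fact (leq_addr b a); rewrite addKn => binE.
rewrite add0n -lognM ?muln_gt0 ?fact_gt0 // binE lognM ?fact_gt0 // !logn_fact //.
have widen n : n <= a + b ->
    \sum_(1 <= k < n.+1) n %/ p ^ k = \sum_(1 <= k < (a + b).+1) n %/ p ^ k.
  move=> le_n; rewrite [RHS](big_cat_nat (n := n.+1)) //=.
  rewrite [X in _ = _ + X]big_nat_cond [X in _ = _ + X]big1 ?addn0 // => k.
  case/andP=> /andP[lt_nk _] _; rewrite divn_small //.
  exact: leq_trans lt_nk (ltnW (ltn_expl _ (prime_gt1 pP))).
rewrite (widen a) ?leq_addr // (widen b) ?leq_addl // -big_split /=.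
apply/eqP; apply: eq_bigr => k _.
by rewrite divnD ?expn_gt0 ?prime_gt0 // leqNgt nocarry addn0.
Qed.

(** For [p > 1] and [w > 0], all [N] base [p] digits of [x] equal [(p - 1) / w], so truncating to
    [i <= N] digits leaves [(p ^ i - 1) / w]. *)
Lemma modn_pow_pred_div p N x w i :
  0 < p -> p = 1 %[mod w] -> x * w = (p ^ N).-1 -> (x %% p ^ i) * w <= (p ^ i).-1.
Proof.
move=> p_gt0 p1 xw.
have pos j : 0 < p ^ j by rewrite expn_gt0 p_gt0.
have [le_iN|lt_Ni] := leqP i N; last first.
  apply: leq_trans (leq_mul (leq_mod _ _) (leqnn w)) _; rewrite xw.
  by rewrite -!subn1 leq_sub2r // leq_pexp2l // ltnW.
have dvdw j : w %| (p ^ j).-1.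
  by rewrite -subn1 -eqn_mod_dvd // -modnXm p1 modnXm exp1n.
have [z zE] := dvdnP (dvdw i); have [y yE] := dvdnP (dvdw (N - i)).
have [w0|w_gt0] := posnP w; first by rewrite w0 muln0.
have xE : x = y * p ^ i + z.
  apply/eqP; rewrite -(eqn_pmul2r w_gt0) xw mulnDl -zE mulnAC -yE.
  rewrite -[in X in X == _](subnK le_iN) expnD.
  by have := pos i; have := pos (N - i); nia.
rewrite zE leq_mul2r xE modnMDl; apply/orP; right; exact: leq_mod.
Qed.

(** * The group of [d]-th powers and the size of a sumset *)

Section PowerSubgroup.

Variables (F : finFieldType) (d D : nat).
Hypothesis dD : d * D = #|F|.-1.

Lemma power_subgroup_exp (y : F) : y \in power_subgroup F d -> (y ^+ D = 1)%R.
Proof.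
case/imsetP=> x; rewrite inE => x0 ->; rewrite -exprM dD.
by apply: (mulfI x0); rewrite -exprS prednK ?expf_card ?mulr1 //; apply/card_gt0P; exists x.
Qed.

(** A fibre of the [d]-th power map consists of roots of [X^d - y], so it has at most [d]
    elements. *)
Lemma card_power_subgroup : 0 < d -> D <= #|power_subgroup F d|.
Proof.
move=> d_gt0; rewrite -(leq_pmul2l d_gt0) dD.
have -> : #|F|.-1 = #|[set x : F | x != 0%R]|.
  rewrite -(cardC1 (0%R : F)); apply: eq_card => x.
  by rewrite !inE.
rewrite -sum1_card (partition_big_imset (fun x : F => (x ^+ d)%R)) /= mulnC -sum_nat_const.
apply: leq_sum => y _; rewrite sum1_card.
have nz : ('X^d - y%:P != 0 :> {poly F})%R by rewrite -size_poly_gt0 size_XnsubC.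
rewrite -ltnS -(size_XnsubC y d_gt0) cardE; apply: max_poly_roots nz _ (enum_uniq _).
apply/allP => x; rewrite mem_enum => /andP[_ /eqP <-].
by rewrite rootE !hornerE subrr.
Qed.

End PowerSubgroup.

(** Every restricted sum is the sum over a two-element subset of [A]. *)
Lemma card_restricted_sumset (F : finFieldType) (A : {set F}) :
  #|restricted_sumset A| <= 'C(#|A|, 2).
Proof.
rewrite -cards_draws.
apply: leq_trans (leq_imset_card (fun X : {set F} => \sum_(x in X) x)%R _).
apply: subset_leq_card; apply/subsetP => _ /imsetP[[a b] + ->] /=.
rewrite inE /= => /and3P[aA bA ab].
apply/imsetP; exists [set a; b]; last by rewrite big_setU1 ?inE // big_set1.
by rewrite inE cards2 ab subUset !sub1set aA bA.
Qed.

Theorem theorem1p3 (k d p n : nat) (F : finFieldType)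
    (hk : 3 <= k) (hd : d = 2 * k ^ 2)
    (hp : prime p) (hpd : p = 1 %[mod d])
    (hn : ~~ odd n) (hq : #|F| = p ^ n) :
  forall A : {set F}, restricted_sumset A <> power_subgroup F d.
Proof.
move=> A eqA.
have p_gt1 := prime_gt1 hp; have p_gt0 := prime_gt0 hp.
have d_gt0 : 0 < d by rewrite hd muln_gt0 expn_gt0; lia.
pose h := n./2; have nE : n = h + h by rewrite addnn halfK (negPf hn) subn0.
have h_gt0 : 0 < h.
  rewrite lt0n; apply/eqP => h0.
  by have := card_finNzRing_gt1 F; rewrite hq nE h0.
have [D0 rE] : exists D0, (p ^ h).-1 = D0 * d.
  by apply/dvdnP; rewrite -subn1 -eqn_mod_dvd ?expn_gt0 ?p_gt0 // -modnXm hpd modnXm exp1n.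
have r_gt1 : 1 < p ^ h by rewrite -(exp1n h) ltn_exp2r.
have rE' : p ^ h = (D0 * (2 * k ^ 2)).+1 by rewrite -hd -rE prednK // ltnW.
have D0_gt0 : 0 < D0 by move: r_gt1; rewrite rE' ltnS muln_gt0 => /andP[].
pose t := k * D0; pose D := D0 * (p ^ h).+1.
(* Evenness of [n] enters here: [q - 1 = (p ^ h - 1) (p ^ h + 1)]. *)
have dD : d * D = #|F|.-1.
  by rewrite hq nE expnD /D rE' hd -mulnn; lia.
have A_gt : t + t < #|A|.
  have := card_power_subgroup dD d_gt0; rewrite -eqA => /leq_trans/(_ (card_restricted_sumset A)).
  rewrite ltnNge; apply: contraTN => le_A; rewrite -ltnNge.
  (* If [#|A| <= 2 t], then [2 D <= #|A| (#|A| - 1) <= (2 t)^2 < 2 D]. *)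
  have := mul_bin_diag #|A| 1; rewrite bin1 => binE.
  have : 2 * 'C(#|A|, 2) <= (t + t) * (t + t) by rewrite -binE; apply: leq_mul; lia.
  have : 2 * D = (t + t) * (t + t) + 4 * D0 by rewrite /D rE' /t -mulnn; lia.
  lia.
pose B := take (t + t).+1 (enum A).
have uniqB : uniq B by rewrite take_uniq ?enum_uniq.
have sizeB : size B = (t + t).+1 by rewrite size_takel // -cardE.
have t_gt0 : 0 < t by rewrite muln_gt0 D0_gt0; lia.
have D_gt0 : 0 < D by rewrite muln_gt0 D0_gt0.
have sumB : {in B &, forall a b : F, a != b -> ((b + a) ^+ D = 1)%R}.
  move=> a b /mem_take + /mem_take; rewrite !mem_enum => aA bA ab.
  apply: (power_subgroup_exp dD); rewrite -eqA.
  by apply/imsetP; exists (b, a); rewrite // inE /= aA bA eq_sym.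
(* Modulo [p ^ i], [D] is at most [(p ^ i - 1) / d] and [2 t] at most [(p ^ i - 1) / k]. As
   [1 / 2 + 1 / 3 < 1], no carry occurs. *)
have binF : (('C(D + (t + t), D))%:R != 0 :> F)%R.
  rewrite -(dvdn_pcharf (card_finPcharP hq hp)); apply: prime_ndvd_bin_no_carry => // i.
  have hpk : p = 1 %[mod k].
    apply/eqP; rewrite eqn_mod_dvd // ; apply: (@dvdn_trans d).
      by rewrite hd -mulnn mulnA dvdn_mull.
    by rewrite -eqn_mod_dvd // hpd.
  have tk : (t + t) * k = (p ^ h).-1 by rewrite rE' /t -mulnn /=; lia.
  have Dd : D * d = (p ^ n).-1 by rewrite mulnC dD hq.
  have := modn_pow_pred_div i p_gt0 hpk tk.
  have := modn_pow_pred_div i p_gt0 hpd Dd.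
  have : 0 < p ^ i by rewrite expn_gt0 p_gt0.
  move: (D %% p ^ i) ((t + t) %% p ^ i) => x y; move: (p ^ i) => P P_gt0.
  have k_gt0 : 0 < k by apply: leq_trans hk.
  have d_ge : 2 <= d by rewrite hd leq_pmulr // expn_gt0 k_gt0.
  move=> xP yP; have := leq_trans (leq_mul (leqnn x) d_ge) xP.
  have := leq_trans (leq_mul (leqnn y) hk) yP.
  by move: P_gt0; clear; lia.
have := pairwise_sum_root_bound uniqB sizeB t_gt0 D_gt0 sumB binF.
(* The bound [(2 t + 1) t <= D] now says [t <= 2 D0], against [t = k D0 >= 3 D0]. *)
have -> : D = (t + t) * t + 2 * D0 by rewrite /D rE' /t -mulnn; lia.
have : 3 * D0 <= t by rewrite leq_mul2r hk orbT.
rewrite sizeB; lia.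
Qed.
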